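(* Let $\pi$ be a projective unitary representation of a countable group $G$ on a Hilbert space $H$. Suppose that $\bigcup_{i=1}^k\{\pi(g)\xi_i\}_{g\in G}$ is a Bessel sequence, and let $M=\overline{span}\bigcup_{i=1}^k\{\pi(g)\xi_i\}_{g\in G}$. Then there exists a vector $\vec\eta=(\eta_1,\dots,\eta_k)$ such that (i) $\bigcup_{i=1}^k\{\pi(g)\eta_i\}_{g\in G}$ is a Parseval frame for $M$, and (ii) $\Theta_{\vec\eta,\pi}(H)=[\Theta_{\vec\xi,\pi}(H)]$.
   Context: A projective unitary representation of $G$ on $H$ is a map $g\mapsto\pi(g)$ into unitaries with $\pi(g)\pi(h)=\mu(g,h)\pi(gh)$, $\mu:G\times G\to\mathbb{T}$. For $\xi\in H$, $\Theta_{\xi,\pi}(x)=\sum_{g\in G}\langle x,\pi(g)\xi\rangle\chi_g\in\ell^2(G)$ ($\{\chi_g\}$ the standard basis), and for $\vec\xi=(\xi_1,\dots,\xi_k)$, $\Theta_{\vec\xi,\pi}:H\to\ell^2(G)^{(k)}$, $\Theta_{\vec\xi,\pi}(x)=\Theta_{\xi_1,\pi}(x)\oplus\cdots\oplus\Theta_{\xi_k,\pi}(x)$. $[K]$ denotes the closed linear span of a set $K$. *)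

(* Defs.v *)
From HB Require Import structures.
From mathcomp Require Import all_boot all_order all_algebra.
From mathcomp Require Import complex.
From mathcomp Require Import boolp classical_sets reals constructive_ereal ereal esum.
Set Implicit Arguments. Unset Strict Implicit. Unset Printing Implicit Defensive.
Import Order.TTheory GRing.Theory Num.Theory.
Local Open Scope ring_scope.
Local Open Scope classical_set_scope.

Section Hilbert.
Variable R : realType.
Local Notation C := R[i].

Definition cabs2 (z : C) : R := complex.Re z ^+ 2 + complex.Im z ^+ 2.

Section InnerProduct.
Variable H : lmodType C.
Variable ip : H -> H -> C.   (* linear in the first, conjugate-linear in the second argument *)

Definition hnorm (x : H) : R := Num.sqrt (complex.Re (ip x x)).

Definition is_hilbert : Prop :=
  [/\ (forall (a : C) (x y z : H), ip (a *: x + y) z = a * ip x z + ip y z),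
      (forall x y : H, ip y x = Num.conj (ip x y)),
      (forall x : H, 0 <= ip x x),
      (forall x : H, ip x x = 0 -> x = 0) &
      (forall u : nat -> H,
          (forall eps : R, 0 < eps -> exists N : nat, forall m n : nat,
              (N <= m)%N -> (N <= n)%N -> hnorm (u m - u n) < eps) ->
          exists l : H, forall eps : R, 0 < eps -> exists N : nat,
              forall n : nat, (N <= n)%N -> hnorm (u n - l) < eps)].

Definition hspan (S : set H) : set H :=
  [set y | exists (n : nat) (c : 'I_n -> C) (v : 'I_n -> H),
             (forall j, S (v j)) /\ y = \sum_(j < n) c j *: v j].

Definition closed_span (S : set H) : set H :=
  [set x | forall eps : R, 0 < eps -> exists2 y, hspan S y & hnorm (x - y) < eps].

Definition is_group (G : Type) (mul : G -> G -> G) (one : G) (inv : G -> G) : Prop :=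
  [/\ forall a b c, mul a (mul b c) = mul (mul a b) c,
      forall a, mul one a = a,
      forall a, mul a one = a,
      forall a, mul (inv a) a = one &
      forall a, mul a (inv a) = one].

Definition is_unitary (U : H -> H) : Prop :=
  [/\ (forall (a : C) (x y : H), U (a *: x + y) = a *: U x + U y),
      (forall x y : H, ip (U x) (U y) = ip x y) &
      (forall y : H, exists x, U x = y)].

Definition is_proj_unitary_rep (G : Type) (mul : G -> G -> G) (pi : G -> H -> H) : Prop :=
  (forall g, is_unitary (pi g)) /\
  exists mu : G -> G -> C,
    (forall g h, `|mu g h| = 1) /\
    (forall g h x, pi g (pi h x) = mu g h *: pi (mul g h) x).

Section Orbits.
Variables (G : choiceType) (pi : G -> H -> H) (k : nat).

Definition orbit_set (xi : 'I_k -> H) : set H :=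
  [set y | exists (i : 'I_k) (g : G), y = pi g (xi i)].

Definition frame_sum (xi : 'I_k -> H) (x : H) : \bar R :=
  (\sum_(i < k) \esum_(g in [set: G]) (cabs2 (ip x (pi g (xi i))))%:E)%E.

Definition is_bessel (xi : 'I_k -> H) : Prop :=
  exists B : R, forall x : H, (frame_sum xi x <= (B * hnorm x ^+ 2)%:E)%E.

Definition is_parseval_frame_for (M : set H) (xi : 'I_k -> H) : Prop :=
  (forall i g, M (pi g (xi i))) /\
  (forall x, M x -> frame_sum xi x = (hnorm x ^+ 2)%:E).

(** ell^2(G)^(k) elements are represented as functions 'I_k -> G -> C;
    Theta_{xi,pi}(x) = (sum_g <x, pi(g) xi_i> chi_g)_i *)
Definition Theta (xi : 'I_k -> H) (x : H) : 'I_k -> G -> C :=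
  fun i g => ip x (pi g (xi i)).

Definition l2dist2 (f f' : 'I_k -> G -> C) : \bar R :=
  (\sum_(i < k) \esum_(g in [set: G]) (cabs2 (f i g - f' i g))%:E)%E.

Definition l2span (S : set ('I_k -> G -> C)) : set ('I_k -> G -> C) :=
  [set f | exists (n : nat) (c : 'I_n -> C) (v : 'I_n -> 'I_k -> G -> C),
     (forall j, S (v j)) /\ f = (fun i g => \sum_(j < n) c j * v j i g)].

(** closed linear span in ell^2(G)^(k); a function at finite distance from an
    ell^2 element is itself in ell^2, so this is the closure inside ell^2 *)
Definition l2closed_span (S : set ('I_k -> G -> C)) : set ('I_k -> G -> C) :=
  [set f | forall eps : R, 0 < eps ->
       exists2 f', l2span S f' & (l2dist2 f f' < eps%:E)%E].

End Orbits.
End InnerProduct.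
End Hilbert.

(* Main.v *)
(** Write [Theta] for the analysis operator of the orbit family and rescale so
    that its frame operator [A = Theta^* Theta] satisfies [0 <= A <= 1].  The
    wanted family is [A^(-1/2) pi(g) xi_i].  Although [A^(-1/2)] is unbounded,
    Newton's iteration produces polynomials [p_n(t)] increasing to [t^(-1/2)],
    with defects [e_n = 1 - t p_n^2] decreasing to [0] on [(0, 1]].  All the
    polynomials whose positivity at [A] matters are combinations of
    [t^i (1 - t)^j] with nonnegative coefficients, so no spectral theorem is
    needed.  By monotonicity, [p_n(A) pi(g) xi_i], [A p_n(A) x] and [e_n(A) x]
    converge in norm; the last limit is the projection of [x] onto the
    orthogonal complement of [M].  Thus
    [|Theta p_n(A) x|^2 = |x|^2 - <e_n(A) x, x>] tends to [|x|^2] for [x] in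
    [M], which is the Parseval identity; the new analysis operator is then
    isometric on [M], hence has closed range, and this range contains
    [Theta x], the image of [lim A p_n(A) x].  Since [A] commutes with every
    [pi(g)], the limits form the orbit family of [eta_i = lim p_n(A) xi_i]. *)

Require Import Defs.
From HB Require Import structures.
From mathcomp Require Import all_boot all_order all_algebra.
From mathcomp Require Import complex ring lra.
From mathcomp Require Import boolp classical_sets cardinality fsbigop.
From mathcomp Require Import reals constructive_ereal ereal esum.
Import Order.TTheory GRing.Theory Num.Theory.
Local Open Scope ring_scope.
Local Open Scope classical_set_scope.

Set Implicit Arguments.
Unset Strict Implicit.

(** * Polynomials increasing to t^(-1/2), with positivity certificates *)

Section InverseSqrtIteration.
Variable R : realFieldType.
Implicit Types p q : {poly R}.

(** A syntactic certificate of positivity: the cone is closed under products, and [phi_bernstein]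
    turns membership of [p] into positivity of p(A) as soon as 0 <= A <= 1. *)
Inductive bernstein_cone : {poly R} -> Prop :=
| bernstein_mono c i j : 0 <= c -> bernstein_cone (c *: ('X^i * (1 - 'X) ^+ j))
| bernstein_add p q :
    bernstein_cone p -> bernstein_cone q -> bernstein_cone (p + q).

Lemma bernstein_const c : 0 <= c -> bernstein_cone c%:P.
Proof.
by move=> c0; have := bernstein_mono 0 0 c0; rewrite !expr0 mulr1 alg_polyC.
Qed.

Lemma bernstein0 : bernstein_cone 0.
Proof. by have := bernstein_const (lexx 0); rewrite polyC0. Qed.

Lemma bernstein1 : bernstein_cone 1.
Proof. exact: bernstein_const ler01. Qed.

Lemma bernsteinX : bernstein_cone 'X.
Proof.
by have := bernstein_mono 1 0 ler01; rewrite expr1 expr0 mulr1 scale1r.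
Qed.

Lemma bernstein1X : bernstein_cone (1 - 'X).
Proof.
by have := bernstein_mono 0 1 ler01; rewrite expr1 expr0 mul1r scale1r.
Qed.

Lemma bernstein_mul p q :
  bernstein_cone p -> bernstein_cone q -> bernstein_cone (p * q).
Proof.
elim=> [c i j c0|p1 p2 _ IH1 _ IH2 hq]; last first.
  by rewrite mulrDl; apply: bernstein_add; [apply: IH1|apply: IH2].
elim=> [d k l d0|q1 q2 _ IH1 _ IH2]; last first.
  by rewrite mulrDr; apply: bernstein_add.
suff -> : c *: ('X^i * (1 - 'X) ^+ j) * (d *: ('X^k * (1 - 'X) ^+ l)) =
    (c * d) *: ('X^(i + k) * (1 - 'X) ^+ (j + l)).
  by apply: bernstein_mono; exact: mulr_ge0.
by rewrite -scalerAl -scalerAr scalerA !exprD mulrACA.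
Qed.

Lemma bernstein_exp p n : bernstein_cone p -> bernstein_cone (p ^+ n).
Proof.
move=> hp; elim: n => [|n IH]; first exact: bernstein1.
by rewrite exprS; exact: bernstein_mul.
Qed.

(* Newton's iteration for t^(-1/2), with the defect e = 1 - t p^2 tracked
   alongside; started from 1, both stay in the cone. *)
Fixpoint newton n : {poly R} * {poly R} :=
  if n is m.+1 then
    let: (p, e) := newton m in
    (p * (1 + (2^-1)%:P * e), (3 / 4)%:P * e ^+ 2 + (4^-1)%:P * e ^+ 3)
  else (1, 1 - 'X).
Definition isqrt n := (newton n).1.
Definition defect n := (newton n).2.

Lemma isqrtS n : isqrt n.+1 = isqrt n * (1 + (2^-1)%:P * defect n).
Proof. by rewrite /isqrt /defect /=; case: (newton n). Qed.

Lemma defectS n :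
  defect n.+1 = (3 / 4)%:P * defect n ^+ 2 + (4^-1)%:P * defect n ^+ 3.
Proof. by rewrite /defect /=; case: (newton n). Qed.

Let h : {poly R} := (2^-1)%:P.
Let h2 (q : {poly R}) : q = 2 * (h * q).
Proof.
by rewrite mulrA -[2 : {poly R}]/(2%:R) -polyC_natr -polyCM divff ?mul1r //.
Qed.
Let hquarter : (4^-1)%:P = h * h.
Proof. by rewrite -polyCM; congr (_%:P); field. Qed.
Let hthree : (3 / 4)%:P = 3 * (h * h).
Proof.
by rewrite -[3 : {poly R}]/(3%:R) -polyC_natr -!polyCM; congr (_%:P); field.
Qed.
(** Written in [u], half the defect, the recursion has integer coefficients, so [ring] can treat it
    over [{poly R}], which has no division. *)
Let defectSE n : let u := h * defect n in
  [/\ defect n = 2 * u, defect n.+1 = 3 * u ^+ 2 + 2 * u ^+ 3 &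
      isqrt n.+1 = isqrt n * (1 + u)].
Proof.
move=> u; have E : defect n = 2 * u by exact: h2.
split=> //; last by rewrite isqrtS.
rewrite defectS hquarter hthree.
transitivity (3 * u ^+ 2 + u ^+ 2 * defect n); first by rewrite /u; ring.
by rewrite E; ring.
Qed.

(** One Newton step preserves the relation because (1 - e)(1 + e/2)^2 = 1 - 3e^2/4 - e^3/4. *)
Lemma isqrt_defect n : 'X * isqrt n ^+ 2 = 1 - defect n.
Proof.
elim: n => [|n IH]; first by rewrite /isqrt /defect /=; ring.
have [E -> ->] := defectSE n; rewrite E in IH.
by ring: IH.
Qed.

Lemma bernstein_defect n : bernstein_cone (defect n).
Proof.
elim: n => [|n IH]; first exact: bernstein1X.
rewrite defectS; apply: bernstein_add; apply: bernstein_mul;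
  (try exact: bernstein_exp); apply: bernstein_const; lra.
Qed.

Lemma bernstein_isqrt n : bernstein_cone (isqrt n).
Proof.
elim: n => [|n IH]; first exact: bernstein1.
rewrite isqrtS; apply: bernstein_mul => //; apply: bernstein_add.
  exact: bernstein1.
by apply: bernstein_mul (bernstein_defect n); apply: bernstein_const; lra.
Qed.

(** Each increment is p_(n+1) - p_n = p_n e_n / 2, a product of cone elements. *)
Lemma bernstein_isqrtB m n : (m <= n)%N -> bernstein_cone (isqrt n - isqrt m).
Proof.
move=> /subnKC <-; elim: (n - m)%N => [|d IH].
  by rewrite addn0 subrr; exact: bernstein0.
rewrite addnS isqrtS.
have -> : isqrt (m + d) * (1 + (2^-1)%:P * defect (m + d)) - isqrt m =
  (isqrt (m + d) - isqrt m) + (2^-1)%:P * (isqrt (m + d) * defect (m + d)).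
  by ring.
apply: bernstein_add => //; apply: bernstein_mul.
  by apply: bernstein_const; lra.
by apply: bernstein_mul; [exact: bernstein_isqrt|exact: bernstein_defect].
Qed.

Lemma bernstein_1defect n : bernstein_cone (1 - defect n).
Proof.
rewrite -isqrt_defect; apply: bernstein_mul; first exact: bernsteinX.
exact/bernstein_exp/bernstein_isqrt.
Qed.

(** Since 1 - e_n = t p_n^2, the drop e_n - e_(n+1) equals t e_n p_n^2 (1 + e_n/4), and p_n - 1 lies
    in the cone. The lower bound t e_n on the drop is what later forces t e_n to 0 at the
    operator. *)
Lemma bernstein_defect_drop n :
  bernstein_cone (defect n - defect n.+1 - 'X * defect n).
Proof.
set e := defect n; set p := isqrt n.
have -> : e - defect n.+1 - 'X * e =
    'X * (e * ((p - 1) ^+ 2 + 2 * (p - 1) + (4^-1)%:P * (p ^+ 2 * e))).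
  have [E -> _] := defectSE n; have F := isqrt_defect n.
  rewrite -/e -/p in E F; rewrite hquarter.
  have -> : h * h * (p ^+ 2 * e) = h * (h * e) * p ^+ 2 by ring.
  rewrite -/e; set u := h * e in E *.
  have -> : 'X * (e * ((p - 1) ^+ 2 + 2 * (p - 1) + h * u * p ^+ 2)) =
    'X * p ^+ 2 * (e + u * u) - 'X * e by rewrite /u; ring.
  by rewrite F E; ring.
have hp : bernstein_cone (p - 1) by exact: (@bernstein_isqrtB 0 n).
have he := bernstein_defect n; have hp' := bernstein_isqrt n.
apply: bernstein_mul bernsteinX _; apply: bernstein_mul => //.
apply: bernstein_add.
  apply: bernstein_add; first exact: bernstein_exp.
  apply: bernstein_mul => //; apply: (@bernstein_add 1 1); exact: bernstein1.
apply: bernstein_mul; first by apply: bernstein_const; lra.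
by apply: bernstein_mul => //; exact: bernstein_exp.
Qed.

Lemma bernstein_defectB m n : (m <= n)%N ->
  bernstein_cone (defect m - defect n).
Proof.
move=> /subnKC <-; elim: (n - m)%N => [|d IH].
  by rewrite addn0 subrr; exact: bernstein0.
rewrite addnS; have -> : defect m - defect (m + d).+1 =
  (defect m - defect (m + d)) + ((defect (m + d) - defect (m + d).+1 -
     'X * defect (m + d)) + 'X * defect (m + d)) by ring.
apply: bernstein_add => //; apply: bernstein_add.
  exact: bernstein_defect_drop.
by apply: bernstein_mul; [exact: bernsteinX|exact: bernstein_defect].
Qed.

End InverseSqrtIteration.

(** * Sequences with nonpositive upper limit *)

Section NullSequences.
Variable R : realType.
Implicit Types a b : nat -> R.

(** One-sided on purpose: for nonnegative sequences this is convergence to 0, while comparison needs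
    no lower bound. *)
Definition null a := forall eps : R, 0 < eps ->
  exists N : nat, forall n : nat, (N <= n)%N -> a n < eps.

Lemma null_le a b : (forall n, a n <= b n) -> null b -> null a.
Proof.
move=> ab hb e /hb[N hN]; exists N => n /hN; exact: le_lt_trans.
Qed.

Lemma null_add a b : null a -> null b -> null (fun n => a n + b n).
Proof.
move=> ha hb e e0; have e20 : 0 < e / 2 by lra.
have [N hN] := ha _ e20; have [N' hN'] := hb _ e20.
exists (maxn N N') => n; rewrite geq_max => /andP[/hN ? /hN' ?]; lra.
Qed.

Lemma null_scale c a : 0 <= c -> null a -> null (fun n => c * a n).
Proof.
move=> c0 ha e e0; have c1 : 0 < c + 1 by lra.
have [N hN] := ha (e / (c + 1)) (divr_gt0 e0 c1).
exists N => n /hN; rewrite ltr_pdivlMr // => h.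
have [an|an] := leP (a n) 0.
  by apply: le_lt_trans e0; exact: mulr_ge0_le0.
by apply: lt_trans h; rewrite mulrDr mulr1 [a n * c]mulrC ltrDl.
Qed.

Lemma null0 : null (fun=> 0).
Proof. by move=> e e0; exists 0%N. Qed.

Lemma null_sum (I : Type) (r : seq I) (F : I -> nat -> R) :
  (forall i, null (F i)) -> null (fun n => \sum_(i <- r) F i n).
Proof.
move=> hF; elim: r => [|i r IH].
  by apply: null_le null0 => n; rewrite big_nil.
by apply: null_le (null_add (hF i) IH) => n; rewrite big_cons.
Qed.

Lemma null_const_from N c a :
  (forall n, (N <= n)%N -> c <= a n) -> null a -> c <= 0.
Proof.
move=> ca ha; rewrite leNgt; apply/negP => c0.
have [N' /(_ (maxn N N') (leq_maxr _ _))] := ha _ c0.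
by rewrite ltNge ca ?leq_maxl.
Qed.

(** The way limits are used below: with [c] a squared norm or modulus, it yields that the quantity
    vanishes. *)
Lemma null_const c a : (forall n, c <= a n) -> null a -> c <= 0.
Proof. by move=> ca; apply: (@null_const_from 0%N). Qed.

Lemma null_sqr a : null (fun n => a n ^+ 2) -> null a.
Proof.
move=> ha e e0; have [N hN] := ha _ (exprn_gt0 2 e0); exists N => n /hN.
rewrite !ltNge; apply: contra => ea.
by rewrite ler_pXn2r // nnegrE (le_trans (ltW e0)).
Qed.

Lemma null_inv : null (fun n => n.+1%:R^-1).
Proof.
move=> e e0; exists (Num.truncn e^-1) => n hn.
have ei : 0 < e^-1 by rewrite invr_gt0.
rewrite -[ltRHS]invrK ltf_pV2 ?posrE ?ltr0n //.
by apply: lt_le_trans (truncnS_gt _) _; rewrite ler_nat.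
Qed.

Lemma nonincreasing_cauchy a : (forall n, 0 <= a n) ->
  (forall m n, (m <= n)%N -> a n <= a m) ->
  exists l, [/\ 0 <= l, forall n, l <= a n & null (fun n => a n - l)].
Proof.
move=> a0 am; pose E := [set a n | n in [set: nat]].
have hE : has_inf E.
  by split; [exists (a 0%N), 0%N|exists 0 => _ [n _ <-]].
have lE n : inf E <= a n by apply: ge_inf; [case: hE|exists n].
exists (inf E); split=> //.
  by apply: lb_le_inf; [case: hE|move=> _ [n _ <-]].
move=> e e0; have [_ [N _ <-] h] := inf_adherent e0 hE.
by exists N => n /am h2; lra.
Qed.

End NullSequences.

(** * Squared modulus of complex numbers *)

Section SquaredModulus.
Variable R : realType.
Implicit Types z w : R[i].

Lemma cabs2_ge0 z : 0 <= cabs2 z.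
Proof. by apply: addr_ge0; exact: sqr_ge0. Qed.

Lemma cabs2M z w : cabs2 (z * w) = cabs2 z * cabs2 w.
Proof. by case: z w => [a b] [c d]; rewrite /cabs2 /=; ring. Qed.

Lemma cabs2N z : cabs2 (- z) = cabs2 z.
Proof. by case: z => [a b]; rewrite /cabs2 /=; ring. Qed.

Lemma cabs2_conj z : cabs2 z^* = cabs2 z.
Proof. by case: z => [a b]; rewrite /cabs2 /=; ring. Qed.

Lemma mulr_conj z : z * z^* = (cabs2 z)%:C%C.
Proof. by case: z => [a b]; rewrite /cabs2 /=; simpc; congr Complex; ring. Qed.

Lemma cabs2_eq0 z : cabs2 z <= 0 -> z = 0.
Proof.
case: z => [a b]; rewrite /cabs2 /= => h.
have := sqr_ge0 a; have := sqr_ge0 b => ha hb.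
by congr Complex; apply/eqP; rewrite -sqrf_eq0; apply/eqP; lra.
Qed.

Lemma cabs2_normr1 z : `|z| = 1 -> cabs2 z = 1.
Proof.
move=> h; apply: (@complexI R); rewrite add_Re2_Im2 h expr1n.
by [].
Qed.

Lemma cabs2D_le z w : cabs2 (z + w) <= 2 * cabs2 z + 2 * cabs2 w.
Proof.
case: z w => [a b] [c d]; rewrite /cabs2 /=.
have := sqr_ge0 (a - c); have := sqr_ge0 (b - d); nra.
Qed.

Lemma cabs2_real (r : R) : cabs2 r%:C%C = r ^+ 2.
Proof. by rewrite /cabs2 /= expr0n addr0. Qed.

(** In each real coordinate the two sides differ by d^-1 (d t - (s - t))^2. Unlike in [cabs2D_le],
    the weight on [w] can be brought close to 1, which keeps the Parseval constant sharp. *)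
Lemma cabs2_young (d : R) z w : 0 < d ->
  cabs2 z <= (1 + d) * cabs2 w + (1 + d^-1) * cabs2 (z - w).
Proof.
move=> d0; case: z w => [a b] [c e]; rewrite /cabs2 /=.
have y (s t : R) : s ^+ 2 <= (1 + d) * t ^+ 2 + (1 + d^-1) * (s - t) ^+ 2.
  rewrite -subr_ge0.
  have -> : (1 + d) * t ^+ 2 + (1 + d^-1) * (s - t) ^+ 2 - s ^+ 2 =
    d^-1 * (d * t - (s - t)) ^+ 2 by field; apply/lt0r_neq0.
  by rewrite mulr_ge0 ?sqr_ge0 // invr_ge0 ltW.
by have := y a c; have := y b e; lra.
Qed.

End SquaredModulus.

(** * Hilbert space geometry, norm limits and closed spans *)

Section HilbertSpace.
Variables (R : realType) (H : lmodType R[i]) (ip : H -> H -> R[i]).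
Hypothesis hilb : is_hilbert ip.
Implicit Types (x y z : H) (a : R[i]).

Definition hn2 x : R := complex.Re (ip x x).

Lemma ip_lin a x y z : ip (a *: x + y) z = a * ip x z + ip y z.
Proof. by case: hilb. Qed.

Lemma ip_conj x y : ip y x = (ip x y)^*.
Proof. by case: hilb => _ /(_ x y). Qed.

Lemma ipDl x y z : ip (x + y) z = ip x z + ip y z.
Proof. by rewrite -[x in LHS]scale1r ip_lin mul1r. Qed.

Lemma ip0l z : ip 0 z = 0.
Proof. by apply: (addrI (ip 0 z)); rewrite -ipDl !addr0. Qed.

Lemma ipZl a x z : ip (a *: x) z = a * ip x z.
Proof. by rewrite -[a *: x]addr0 ip_lin ip0l addr0. Qed.

Lemma ipNl x z : ip (- x) z = - ip x z.
Proof. by rewrite -scaleN1r ipZl mulN1r. Qed.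

Lemma ipBl x y z : ip (x - y) z = ip x z - ip y z.
Proof. by rewrite ipDl ipNl. Qed.

Lemma ipDr x y z : ip z (x + y) = ip z x + ip z y.
Proof. by rewrite ip_conj ipDl rmorphD /= -!ip_conj. Qed.

Lemma ipZr a x z : ip z (a *: x) = a^* * ip z x.
Proof. by rewrite ip_conj ipZl rmorphM /= -ip_conj. Qed.

Lemma ip0r z : ip z 0 = 0.
Proof. by rewrite ip_conj ip0l rmorph0. Qed.

Lemma ipNr x z : ip z (- x) = - ip z x.
Proof. by rewrite ip_conj ipNl rmorphN /= -ip_conj. Qed.

Lemma ipBr x y z : ip z (x - y) = ip z x - ip z y.
Proof. by rewrite ipDr ipNr. Qed.

Lemma ip_suml (I : Type) (r : seq I) (F : I -> H) z :
  ip (\sum_(i <- r) F i) z = \sum_(i <- r) ip (F i) z.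
Proof.
elim: r => [|i r IH]; first by rewrite !big_nil ip0l.
by rewrite !big_cons ipDl IH.
Qed.

Lemma ip_sumr (I : Type) (r : seq I) (F : I -> H) z :
  ip z (\sum_(i <- r) F i) = \sum_(i <- r) ip z (F i).
Proof.
elim: r => [|i r IH]; first by rewrite !big_nil ip0r.
by rewrite !big_cons ipDr IH.
Qed.

Lemma ReD (u v : R[i]) : complex.Re (u + v) = complex.Re u + complex.Re v.
Proof. by case: u v => [? ?] [? ?]. Qed.

Lemma ReN (u : R[i]) : complex.Re (- u) = - complex.Re u.
Proof. by case: u => [? ?]. Qed.

Lemma cRe_conj (u : R[i]) : complex.Re u^* = complex.Re u.
Proof. by case: u => [? ?]. Qed.

Lemma ReZ (r : R) (u : R[i]) : complex.Re (r%:C%C * u) = r * complex.Re u.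
Proof. by case: u => [? ?] /=; ring. Qed.

Lemma Re_sum (I : Type) (r : seq I) (F : I -> R[i]) :
  complex.Re (\sum_(i <- r) F i) = \sum_(i <- r) complex.Re (F i).
Proof.
elim: r => [|i r IH]; first by rewrite !big_nil.
by rewrite !big_cons ReD IH.
Qed.

Lemma hn2_ge0 x : 0 <= hn2 x.
Proof. by case: hilb => _ _ /(_ x); rewrite lecE => /andP[]. Qed.

Lemma ipxx x : ip x x = (hn2 x)%:C%C.
Proof.
case: hilb => _ _ /(_ x); rewrite lecE /hn2; case: (ip x x) => a b /=.
by move=> /andP[/eqP -> _].
Qed.

Lemma hn2_eq0 x : hn2 x <= 0 -> x = 0.
Proof.
move=> h; case: hilb => _ _ _ h0 _; apply: h0; rewrite ipxx.
by have -> : hn2 x = 0 by apply/eqP; rewrite eq_le h hn2_ge0.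
Qed.

Lemma hnorm2 x : hnorm ip x ^+ 2 = hn2 x.
Proof. by rewrite sqr_sqrtr ?hn2_ge0. Qed.

Lemma hnorm_lt x (e : R) : 0 < e -> (hnorm ip x < e) = (hn2 x < e ^+ 2).
Proof.
move=> e0; rewrite -hnorm2 ltr_pXn2r // nnegrE; last exact: ltW.
exact: sqrtr_ge0.
Qed.

Lemma hn2D x y : hn2 (x + y) = hn2 x + 2 * complex.Re (ip x y) + hn2 y.
Proof.
by rewrite /hn2 ipDl !ipDr !ReD (ip_conj x y) cRe_conj; ring.
Qed.

Lemma hn2N x : hn2 (- x) = hn2 x.
Proof. by rewrite /hn2 ipNl ipNr opprK. Qed.

Lemma hn2B x y : hn2 (x - y) = hn2 x - 2 * complex.Re (ip x y) + hn2 y.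
Proof. by rewrite hn2D hn2N ipNr ReN; ring. Qed.

Lemma hn2BC x y : hn2 (x - y) = hn2 (y - x).
Proof. by rewrite -hn2N opprB. Qed.

Lemma hn2Z a x : hn2 (a *: x) = cabs2 a * hn2 x.
Proof. by rewrite /hn2 ipZl ipZr mulrA mulr_conj ReZ. Qed.

Lemma hn2D_le x y : hn2 (x + y) <= 2 * hn2 x + 2 * hn2 y.
Proof. by have := hn2_ge0 (x - y); rewrite hn2B hn2D; lra. Qed.

Lemma hn2_tri x y z : hn2 (x - z) <= 2 * hn2 (y - x) + 2 * hn2 (y - z).
Proof. by rewrite (hn2BC y x) -[x - z](subrKA y); exact: hn2D_le. Qed.

Lemma cauchy_schwarz x y : cabs2 (ip x y) <= hn2 x * hn2 y.
Proof.
have [y0|y0] := leP (hn2 y) 0.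
  by rewrite (hn2_eq0 y0) ip0r /cabs2 /= expr0n addr0 /hn2 ip0r mulr0.
(* The squared norm of this vector is |y|^2 (|x|^2 |y|^2 - |<x,y>|^2). *)
have := hn2_ge0 ((hn2 y)%:C%C *: x - ip x y *: y).
rewrite hn2B !hn2Z ipZl ipZr cabs2_real [_^* * _]mulrC mulr_conj ReZ /=.
move=> h; rewrite -subr_ge0 -(pmulr_rge0 _ y0); move: h; congr (0 <= _); ring.
Qed.

Definition hcvg (u : nat -> H) x := null (fun n => hn2 (u n - x)).

Lemma hcvg_unique u x y : hcvg u x -> hcvg u y -> x = y.
Proof.
move=> ux uy; apply/eqP; rewrite -subr_eq0; apply/eqP/hn2_eq0.
have c2 : (0 : R) <= 2 by [].
apply: null_const (null_add (null_scale c2 ux) (null_scale c2 uy)) => //.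
by move=> n; exact: hn2_tri.
Qed.

Lemma hcvg_lin u v a x y : hcvg u x -> hcvg v y ->
  hcvg (fun n => a *: u n + v n) (a *: x + y).
Proof.
move=> ux vy; have c0 : 0 <= 2 * cabs2 a by rewrite mulr_ge0 ?cabs2_ge0.
have c2 : (0 : R) <= 2 by [].
apply: null_le (null_add (null_scale c0 ux) (null_scale c2 vy)) => n.
rewrite opprD addrACA -scalerBr; apply: le_trans (hn2D_le _ _) _.
by rewrite hn2Z; lra.
Qed.

Lemma hcvg_ipl u x y : hcvg u x -> null (fun n => cabs2 (ip (u n) y - ip x y)).
Proof.
move=> ux; apply: null_le (null_scale (hn2_ge0 y) ux) => n.
by rewrite -ipBl mulrC cauchy_schwarz.
Qed.

Lemma hcvg_ipr u x y : hcvg u x -> null (fun n => cabs2 (ip y (u n) - ip y x)).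
Proof.
move=> ux; apply: null_le (null_scale (hn2_ge0 y) ux) => n.
by rewrite -ipBr cauchy_schwarz.
Qed.

Lemma hn2_complete (u : nat -> H) :
  (forall eps : R, 0 < eps -> exists N : nat, forall m n : nat,
     (N <= m)%N -> (m <= n)%N -> hn2 (u m - u n) < eps) ->
  exists l, hcvg u l.
Proof.
move=> cu; case: hilb => _ _ _ _ /(_ u)[e e0|l hl].
  have [N hN] := cu _ (exprn_gt0 2 e0); exists N => m n Nm Nn.
  rewrite hnorm_lt //; have [mn|nm] := leqP m n; first exact: hN.
  by rewrite hn2BC; apply: hN => //; exact: ltnW.
exists l => e e0; have se : 0 < Num.sqrt e by rewrite sqrtr_gt0.
have [N hN] := hl _ se; exists N => n /hN.
by rewrite hnorm_lt // sqr_sqrtr // ltW.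
Qed.

(** Here [a] is nonincreasing and bounded below, hence Cauchy, and [u] inherits this. It replaces
    the monotone convergence theorem for operators. *)
Lemma hcvg_monotone (u : nat -> H) (a : nat -> R) : (forall n, 0 <= a n) ->
  (forall m n, (m <= n)%N -> hn2 (u m - u n) <= a m - a n) ->
  exists l, hcvg u l.
Proof.
move=> a0 ua; have am m n : (m <= n)%N -> a n <= a m.
  by move=> /ua h; have := hn2_ge0 (u m - u n); lra.
have [l [l0 la nl]] := nonincreasing_cauchy a0 am.
apply: hn2_complete => e /nl[N hN]; exists N => m n Nm mn.
have := hN _ Nm; have := la n; have := ua _ _ mn; lra.
Qed.

(* 0 <= <P(x - Px), x - Px> and <P(Px), Px> <= |Px|^2. *)
Lemma contraction_sq (P : H -> H) : (forall x y, P (x - y) = P x - P y) ->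
  (forall x y, ip (P x) y = ip x (P y)) ->
  (forall x, 0 <= complex.Re (ip (P x) x) <= hn2 x) ->
  forall x, hn2 (P x) <= complex.Re (ip (P x) x).
Proof.
move=> PB Ps P01 x; have /andP[+ _] := P01 (x - P x).
have /andP[_ h] := P01 (P x); rewrite PB ipBl !ipBr !(ReD, ReN).
have -> : complex.Re (ip (P (P x)) x) = hn2 (P x) by rewrite Ps.
by rewrite -/(hn2 (P x)); lra.
Qed.

Section ClosedSpan.
Variable S : set H.
Local Notation M := (closed_span ip S).

Lemma closed_spanP x : M x <->
  forall eps : R, 0 < eps -> exists2 y, hspan S y & hn2 (x - y) < eps.
Proof.
split=> h e e0.
  have se : 0 < Num.sqrt e by rewrite sqrtr_gt0.
  have [y hy xy] := h _ se; exists y => //.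
  by move: xy; rewrite hnorm_lt // sqr_sqrtr // ltW.
by have [y hy xy] := h _ (exprn_gt0 2 e0); exists y => //; rewrite hnorm_lt.
Qed.

Lemma hspan_sub x : S x -> hspan S x.
Proof.
move=> Sx; exists 1%N, (fun=> 1), (fun=> x); split=> //.
by rewrite big_ord1 scale1r.
Qed.

Lemma hspan0 : hspan S 0.
Proof.
exists 0%N, (fun=> 0), (fun=> 0); split; first by case.
by rewrite big_ord0.
Qed.

Lemma hspan_lin a x y : hspan S x -> hspan S y -> hspan S (a *: x + y).
Proof.
move=> [m [c [v [Sv ->]]]] [n [d [w [Sw ->]]]].
exists (m + n)%N,
  (fun j => match split j with inl i => a * c i | inr i => d i end),
  (fun j => match split j with inl i => v i | inr i => w i end); split.
  by move=> j; case: (split j).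
rewrite big_split_ord /= scaler_sumr; congr (_ + _); apply: eq_bigr => i _.
  by rewrite (unsplitK (inl i)) scalerA.
by rewrite (unsplitK (inr i)).
Qed.

Lemma closed_span_sub x : hspan S x -> M x.
Proof.
move=> Sx; apply/closed_spanP => e e0; exists x => //.
by rewrite subrr /hn2 ip0l.
Qed.

Lemma closed_span_cvg u x : (forall n, M (u n)) -> hcvg u x -> M x.
Proof.
move=> Mu ux; apply/closed_spanP => e e0; have e4 : 0 < e / 4 by lra.
have [N /(_ N (leqnn _)) hN] := ux _ e4.
have /closed_spanP/(_ _ e4)[y Sy hy] := Mu N; exists y => //.
have := hn2_tri x (u N) y; lra.
Qed.

Lemma closed_span_lin a x y : M x -> M y -> M (a *: x + y).
Proof.
move=> /closed_spanP Mx /closed_spanP My; apply/closed_spanP => e e0.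
have c0 := cabs2_ge0 a; have c1 : 0 < 1 + cabs2 a by lra.
have e4 : 0 < e / 4 by lra.
have [x' Sx' hx] := Mx (e / 4 / (1 + cabs2 a)) (divr_gt0 e4 c1).
have [y' Sy' hy] := My _ e4.
exists (a *: x' + y'); first exact: hspan_lin.
rewrite opprD addrACA -scalerBr; apply: le_lt_trans (hn2D_le _ _) _.
move: hx; rewrite ltr_pdivlMr // hn2Z.
have := hn2_ge0 (x - x'); lra.
Qed.

(** For [y] in the span, <z,x> = <z,x-y>, which Cauchy-Schwarz makes arbitrarily small. *)
Lemma closed_span_perp z : (forall y, S y -> ip z y = 0) ->
  forall x, M x -> ip z x = 0.
Proof.
move=> zS x /closed_spanP Mx; apply: cabs2_eq0.
have zs y : hspan S y -> ip z y = 0.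
  move=> [n [c [v [Sv ->]]]]; rewrite ip_sumr big1 // => j _.
  by rewrite ipZr zS // mulr0.
rewrite leNgt; apply/negP => h; have c1 : 0 < 1 + hn2 z.
  by have := hn2_ge0 z; lra.
have [y /zs zy xy] := Mx _ (divr_gt0 h c1).
move: xy; rewrite ltr_pdivlMr // -[ip z x]subr0 -zy -ipBr.
have := cauchy_schwarz z (x - y); have := hn2_ge0 (x - y); lra.
Qed.

End ClosedSpan.

Lemma closed_span_scale (S S' : set H) a : a != 0 ->
  (forall y, S y -> S' (a *: y)) ->
  forall x, closed_span ip S x -> closed_span ip S' x.
Proof.
move=> a0 SS' x /closed_spanP h; apply/closed_spanP => e.
move=> /h[z [n [d [u [Su ->]]]] hz]; exists (\sum_(j < n) d j *: u j) => //.
exists n, (fun j => d j / a), (fun j => a *: u j); split=> [j|].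
  exact: SS'.
by apply: eq_bigr => j _; rewrite scalerA divfK.
Qed.

End HilbertSpace.

Lemma linear_fun0 (K : pzRingType) (V W : lmodType K) (f : V -> W) :
  (forall a x y, f (a *: x + y) = a *: f x + f y) -> f 0 = 0.
Proof.
move=> lin; have := lin 1 0 0; rewrite !scale1r addr0 => h.
by apply: (addrI (f 0)); rewrite addr0.
Qed.

(** * Polynomial calculus of a symmetric operator between 0 and 1 *)

Section FunctionalCalculus.
Variables (R : realType) (H : lmodType R[i]) (ip : H -> H -> R[i]).
Hypothesis hilb : is_hilbert ip.
Variable A : H -> H.
Hypothesis A_lin : forall (a : R[i]) (x y : H), A (a *: x + y) = a *: A x + A y.
Hypothesis A_sym : forall x y, ip (A x) y = ip x (A y).
Hypothesis A01 : forall x, 0 <= complex.Re (ip (A x) x) <= hn2 ip x.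
Implicit Types (p q : {poly R}) (x y : H).
Local Notation hn2 := (hn2 ip).

(** The operator p(A); restricting to real coefficients makes it symmetric. *)
Definition op p x : H := \sum_(i < size p) (p`_i)%:C%C *: iter i A x.

Lemma opE n p x : (size p <= n)%N ->
  op p x = \sum_(i < n) (p`_i)%:C%C *: iter i A x.
Proof.
move=> pn.
rewrite /op (big_ord_widen n (fun i => (p`_i)%:C%C *: iter i A x)) //.
rewrite big_mkcond; apply: eq_bigr => i _; case: ltnP => // pi.
by rewrite nth_default // scale0r.
Qed.

Let A0 : A 0 = 0.
Proof. exact: linear_fun0 A_lin. Qed.

Lemma opD p q x : op (p + q) x = op p x + op q x.
Proof.
rewrite (opE _ (size_polyD p q)) (opE _ (leq_maxl (size p) (size q))).
rewrite (opE _ (leq_maxr (size p) (size q))) -big_split /=.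
by apply: eq_bigr => i _; rewrite coefD rmorphD /= scalerDl.
Qed.

Lemma opZ c p x : op (c *: p) x = c%:C%C *: op p x.
Proof.
rewrite (opE _ (size_scale_leq c p)) /op scaler_sumr.
by apply: eq_bigr => i _; rewrite coefZ rmorphM /= scalerA.
Qed.

Lemma opN p x : op (- p) x = - op p x.
Proof. by rewrite -[- p]scaleN1r opZ rmorphN rmorph1 scaleN1r. Qed.

Lemma opB p q x : op (p - q) x = op p x - op q x.
Proof. by rewrite opD opN. Qed.

Lemma opC c x : op c%:P x = c%:C%C *: x.
Proof. by rewrite (opE _ (size_polyC_leq1 c)) big_ord1 coefC. Qed.

Lemma op1 x : op 1 x = x.
Proof. by rewrite opC rmorph1 scale1r. Qed.

Lemma op_mulX p x : op (p * 'X) x = op p (A x).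
Proof.
rewrite (@opE (size p).+1); last first.
  by apply: leq_trans (size_polyMleq _ _) _; rewrite size_polyX addn2.
rewrite big_ord_recl coefMX /= scale0r add0r /op.
by apply: eq_bigr => i _; rewrite coefMX /= -iterS iterSr.
Qed.

Lemma opX x : op 'X x = A x.
Proof. by rewrite -['X]mul1r op_mulX op1. Qed.

Lemma op_A p x : op p (A x) = A (op p x).
Proof.
have AD : {morph A : y z / y + z}.
  by move=> y z; rewrite -[y in LHS]scale1r A_lin scale1r.
rewrite /op (big_morph A AD A0); apply: eq_bigr => i _.
by rewrite -[_ *: iter i A x]addr0 A_lin A0 addr0 -iterSr.
Qed.

Lemma opM p q x : op (p * q) x = op p (op q x).
Proof.
elim/poly_ind: p x => [|p c IH] x.
  by rewrite mul0r /op size_poly0 !big_ord0.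
rewrite mulrDl !opD mul_polyC opZ opC op_mulX; congr (_ + _).
by rewrite mulrAC op_mulX IH op_A.
Qed.

Lemma op_comm (U : H -> H) :
  (forall (a : R[i]) x y, U (a *: x + y) = a *: U x + U y) ->
  (forall x, A (U x) = U (A x)) -> forall p x, op p (U x) = U (op p x).
Proof.
move=> U_lin UA p x; have U0 := linear_fun0 U_lin.
elim/poly_ind: p x => [|p c IH] x; first by rewrite /op size_poly0 !big_ord0 U0.
by rewrite !opD !op_mulX UA IH !opC addrC -U_lin addrC.
Qed.

Lemma op_sym p x y : ip (op p x) y = ip x (op p y).
Proof.
elim/poly_ind: p x y => [|p c IH] x y.
  by rewrite /op size_poly0 !big_ord0 ip0l // ip0r.
rewrite !opD !op_mulX !opC ipDl // ipDr // ipZl // ipZr // IH A_sym op_A.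
by rewrite [X in _ + _ = _ + X * _]conjc_real.
Qed.

Definition phi p x : R := complex.Re (ip (op p x) x).

Lemma phiD p q x : phi (p + q) x = phi p x + phi q x.
Proof. by rewrite /phi opD ipDl // ReD. Qed.

Lemma phiB p q x : phi (p - q) x = phi p x - phi q x.
Proof. by rewrite /phi opB ipBl // ReD ReN. Qed.

Lemma phi1 x : phi 1 x = hn2 x.
Proof. by rewrite /phi op1. Qed.

Lemma phiX x : phi 'X x = complex.Re (ip (A x) x).
Proof. by rewrite /phi opX. Qed.

(** Symmetry moves one factor of the square onto the other argument; this reduces inequalities
    between vectors to inequalities between polynomials. *)
Lemma phi_sqr p q x : phi (q * p ^+ 2) x = phi q (op p x).
Proof. by rewrite /phi expr2 mulrA [q * p]mulrC -mulrA opM op_sym opM. Qed.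

Lemma hn2_op p x : hn2 (op p x) = phi (p ^+ 2) x.
Proof. by rewrite -[p ^+ 2]mul1r phi_sqr phi1. Qed.

(** Splitting off even powers leaves a square times 1, t, 1 - t or t(1 - t). The first three are
    positive by hypothesis, and t(1 - t) = (1 - t) t^2 + t (1 - t)^2 reduces the last to them. *)
Lemma phi_bernstein p x : bernstein_cone p -> 0 <= phi p x.
Proof.
elim=> [c i j c0|p1 p2 _ h1 _ h2]; last by rewrite phiD addr_ge0.
rewrite /phi opZ ipZl // ReZ mulr_ge0 // -/(phi _ x).
have -> : 'X^i * (1 - 'X) ^+ j = 'X^(odd i) * (1 - 'X) ^+ (odd j) *
    ('X^(i./2) * (1 - 'X) ^+ (j./2)) ^+ 2 :> {poly R}.
  rewrite exprMn mulrACA -!exprM -!exprD !muln2.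
  by rewrite !odd_double_half.
rewrite phi_sqr; move: (op _ x) => {x} y.
have hX z : 0 <= phi 'X z by rewrite phiX; have /andP[] := A01 z.
have hX' z : 0 <= phi (1 - 'X) z.
  by rewrite phiB phi1 phiX subr_ge0; have /andP[] := A01 z.
case: (odd i) (odd j) => [] [] /=; rewrite ?expr1 ?expr0 ?mulr1 ?mul1r //.
  have -> : 'X * (1 - 'X) = (1 - 'X) * 'X ^+ 2 + 'X * (1 - 'X) ^+ 2 :> {poly R}.
    by ring.
  by rewrite phiD !phi_sqr addr_ge0.
by rewrite phi1 hn2_ge0.
Qed.

Lemma phi_le p q x : bernstein_cone (q - p) -> phi p x <= phi q x.
Proof. by move=> /phi_bernstein -/(_ x); rewrite phiB subr_ge0. Qed.

Local Notation p_ := (isqrt R).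
Local Notation e_ := (defect R).

Lemma phi_defect_ge0 n x : 0 <= phi (e_ n) x.
Proof. exact/phi_bernstein/bernstein_defect. Qed.

Lemma phi_defect_decr x m n : (m <= n)%N -> phi (e_ n) x <= phi (e_ m) x.
Proof. by move=> mn; apply/phi_le/bernstein_defectB. Qed.

(** The terms are bounded by consecutive drops of the convergent sequence [phi (e_ n) x]. *)
Lemma phi_Xdefect_null x : null (fun n => phi ('X * e_ n) x).
Proof.
have [l [l0 la nl]] := nonincreasing_cauchy
  (fun n => phi_defect_ge0 n x) (phi_defect_decr x).
apply: null_le nl => n; apply: le_trans (_ : phi (e_ n - e_ n.+1) x <= _).
  exact/phi_le/bernstein_defect_drop.
by rewrite phiB; have := la n.+1; lra.
Qed.

(** The difference d of the defects satisfies d^2 <= d, as d lies between 0 and 1. *)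
Lemma hn2_defectB x m n : (m <= n)%N ->
  hn2 (op (e_ m) x - op (e_ n) x) <= phi (e_ m) x - phi (e_ n) x.
Proof.
move=> mn; rewrite -opB hn2_op -phiB; apply: phi_le.
set d := e_ m - e_ n.
have -> : d - d ^+ 2 = d * ((1 - e_ m) + e_ n) by rewrite /d; ring.
apply: bernstein_mul; first exact: bernstein_defectB.
by apply: bernstein_add; [exact: bernstein_1defect|exact: bernstein_defect].
Qed.

Lemma op_defect_cvg x : exists l, hcvg ip (fun n => op (e_ n) x) l.
Proof.
apply: (hcvg_monotone hilb (a := fun n => phi (e_ n) x)).
  by move=> n; exact: phi_defect_ge0.
by move=> m n; exact: hn2_defectB.
Qed.

Lemma phi_Xdefect_sqr_le n x : phi ('X * e_ n ^+ 2) x <= phi ('X * e_ n) x.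
Proof.
apply: phi_le; have -> : 'X * e_ n - 'X * e_ n ^+ 2 = 'X * (e_ n * (1 - e_ n)).
  by ring.
apply: bernstein_mul (bernsteinX _) _; apply: bernstein_mul.
  exact: bernstein_defect.
exact: bernstein_1defect.
Qed.

Lemma isqrtB_sqr_cone m n : (m <= n)%N ->
  bernstein_cone (p_ n ^+ 2 - p_ m ^+ 2 - (p_ n - p_ m) ^+ 2).
Proof.
move=> mn; have -> : p_ n ^+ 2 - p_ m ^+ 2 - (p_ n - p_ m) ^+ 2 =
  (p_ n - p_ m) * (p_ m + p_ m) by ring.
apply: bernstein_mul; first exact: bernstein_isqrtB.
by apply: bernstein_add; exact: bernstein_isqrt.
Qed.

(** From (p_n - p_m)^2 <= p_n^2 - p_m^2, multiplied by t, and t p_n^2 = 1 - e_n. It is the Cauchy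
    estimate for A^(1/2) p_n(A) x. *)
Lemma phi_XisqrtB x m n : (m <= n)%N ->
  phi ('X * (p_ n - p_ m) ^+ 2) x <= phi (e_ m) x - phi (e_ n) x.
Proof.
move=> mn; rewrite -phiB; apply: phi_le.
have -> : e_ m - e_ n - 'X * (p_ n - p_ m) ^+ 2 =
  'X * (p_ n ^+ 2 - p_ m ^+ 2 - (p_ n - p_ m) ^+ 2).
  rewrite 2!mulrBr !isqrt_defect; ring.
apply: bernstein_mul (bernsteinX _) _; exact: isqrtB_sqr_cone.
Qed.

(* |p_n(A) z|^4 <= <A p_n(A)^2 z', z'> with z' = p_n(A) z, and t p_n^2 <= 1. *)
Lemma op_isqrt_cvg z :
  (forall x, cabs2 (ip x z) <= complex.Re (ip (A x) x)) ->
  exists l, hcvg ip (fun n => op (p_ n) z) l.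
Proof.
move=> hz; have b n : hn2 (op (p_ n) z) <= 1.
  set y := op (p_ n) z; have := hz (op (p_ n) y).
  rewrite op_sym -phiX -phi_sqr -/y ipxx // cabs2_real => h.
  have : phi ('X * p_ n ^+ 2) y <= hn2 y.
    rewrite -phi1; apply: phi_le; rewrite isqrt_defect opprB addrCA subrr addr0.
    exact: bernstein_defect.
  have := hn2_ge0 hilb y; move: (hn2 y) h => t h t0 h'.
  by rewrite leNgt; apply/negP => t1; nra.
apply: (hcvg_monotone hilb (a := fun n => 1 - hn2 (op (p_ n) z))).
  by move=> n; rewrite subr_ge0.
move=> m n mn; rewrite hn2BC // -opB !hn2_op.
have := phi_bernstein z (isqrtB_sqr_cone mn); rewrite !phiB; lra.
Qed.

(** The limit plays the role of A^(1/2) x. As t <= 1, the square of t (p_n - p_m) is at most t (p_n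
    - p_m)^2, so no condition on [x] arises. *)
Lemma op_Xisqrt_cvg x : exists l, hcvg ip (fun n => op ('X * p_ n) x) l.
Proof.
apply: (hcvg_monotone hilb (a := fun n => phi (e_ n) x)).
  by move=> n; exact: phi_defect_ge0.
move=> m n mn; apply: le_trans (phi_XisqrtB x mn).
rewrite hn2BC // -opB hn2_op; apply: phi_le.
have -> : 'X * (p_ n - p_ m) ^+ 2 - ('X * p_ n - 'X * p_ m) ^+ 2 =
  'X * ((1 - 'X) * (p_ n - p_ m) ^+ 2) by ring.
apply: bernstein_mul (bernsteinX _) _; apply: bernstein_mul (bernstein1X _) _.
exact/bernstein_exp/bernstein_isqrtB.
Qed.

End FunctionalCalculus.

(** * Square-summable families through finite partial sums *)

Section SquareSummable.
Variables (R : realType) (T : choiceType).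
Implicit Types f g : T -> R[i].

(** States that the squared l2 norm is at most [c] without infinite sums; [esum_cabs2_le] links it
    to the extended-real sum. *)
Definition l2le f (c : R) :=
  forall s : seq T, uniq s -> \sum_(t <- s) cabs2 (f t) <= c.

Lemma l2le_point f c t : l2le f c -> cabs2 (f t) <= c.
Proof. by move=> /(_ [:: t]); rewrite big_seq1; apply. Qed.

Lemma l2le_trans f c d : c <= d -> l2le f c -> l2le f d.
Proof. by move=> cd fc s /fc h; exact: le_trans cd. Qed.

Lemma l2le_young (d : R) f g b c : 0 < d -> l2le g b ->
  l2le (fun t => f t - g t) c -> l2le f ((1 + d) * b + (1 + d^-1) * c).
Proof.
move=> d0 gb fgc s us; have di : 0 < d^-1 by rewrite invr_gt0.
apply: le_trans (_ : \sum_(t <- s) ((1 + d) * cabs2 (g t) +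
    (1 + d^-1) * cabs2 (f t - g t)) <= _).
  by apply: ler_sum => t _; exact: cabs2_young.
rewrite big_split /= -!mulr_sumr; apply: lerD; apply: ler_wpM2l.
- by lra.
- exact: gb.
- by lra.
- exact: fgc.
Qed.

Lemma l2le_add f g b c : l2le f b -> l2le g c ->
  l2le (fun t => f t + g t) (2 * b + 2 * c).
Proof.
move=> fb gc s us.
apply: le_trans (_ : \sum_(t <- s) (2 * cabs2 (f t) + 2 * cabs2 (g t)) <= _).
  by apply: ler_sum => t _; exact: cabs2D_le.
rewrite big_split /= -!mulr_sumr; apply: lerD; apply: ler_wpM2l => //.
  exact: fb.
exact: gc.
Qed.

Lemma l2le_opp f c : l2le f c -> l2le (fun t => - f t) c.
Proof. by move=> fc s us; under eq_bigr do rewrite cabs2N; exact: fc. Qed.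

End SquareSummable.

(** First n tends to infinity with [d] fixed, then [d] runs through 1/(n+1). *)
Lemma le_of_young (R : realType) (a b : R) (u : nat -> R) : 0 <= b ->
  null u ->
  (forall d n, 0 < d -> a <= (1 + d) * b + (1 + d^-1) * u n) -> a <= b.
Proof.
move=> b0 nu h.
have h1 d : 0 < d -> a <= (1 + d) * b.
  move=> d0; have di : 0 <= 1 + d^-1 by rewrite addr_ge0 // invr_ge0 ltW.
  rewrite -subr_le0; apply: null_const (null_scale di nu) => n.
  by have := h d n d0; lra.
rewrite -subr_le0; apply: null_const (null_scale b0 (@null_inv R)) => n.
rewrite lerBlDl.
have d0 : (0 : R) < n.+1%:R^-1 by rewrite invr_gt0 ltr0n.
by apply: le_trans (h1 _ d0) _; rewrite mulrDl mul1r mulrC.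
Qed.

(** * The Parseval family and the range of its analysis operator *)

Section ParsevalFamily.
Variables (R : realType) (H : lmodType R[i]) (ip : H -> H -> R[i]).
Hypothesis hilb : is_hilbert ip.
Variables (T : choiceType) (v : T -> H) (A : H -> H).
Hypothesis A_lin : forall (a : R[i]) (x y : H), A (a *: x + y) = a *: A x + A y.
Hypothesis A_sym : forall x y, ip (A x) y = ip x (A y).
Hypothesis A01 : forall x, 0 <= complex.Re (ip (A x) x) <= hn2 ip x.
Local Notation M := (closed_span ip (v @` setT)).
Hypothesis A_M : forall x, M (A x).
(** With [A_le], this says that <Ax,x> is the squared l2 norm of the coefficients of [x]: [A] is the
    frame operator of [v]. *)
Hypothesis A_ge : forall x,
  l2le (fun t => ip x (v t)) (complex.Re (ip (A x) x)).
Hypothesis A_le : forall x c,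
  l2le (fun t => ip x (v t)) c -> complex.Re (ip (A x) x) <= c.
Implicit Types (p q : {poly R}) (x y : H).
Local Notation hn2 := (hn2 ip).
Local Notation hcvg := (hcvg ip).
Local Notation op := (op A).
Local Notation phi := (phi ip A).
Local Notation p_ := (isqrt R).
Local Notation e_ := (defect R).

Lemma isqrt_family_cvg : exists w : T -> H,
  forall t, hcvg (fun n => op (p_ n) (v t)) (w t).
Proof.
have h t : exists l, hcvg (fun n => op (p_ n) (v t)) l.
  apply: op_isqrt_cvg => // x.
  exact: (l2le_point t (A_ge x)).
by have [w hw] := choice h; exists w.
Qed.

Lemma closed_span_op p x : M x -> M (op p x).
Proof.
elim/poly_ind: p x => [|p c IH] x Mx.
  by rewrite /op size_poly0 big_ord0; exact/closed_span_sub/hspan0.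
rewrite opD op_mulX opC addrC; apply: closed_span_lin => //; exact: IH.
Qed.

(** A single coefficient is controlled by <A e_n(A)x, e_n(A)x>, and t e_n^2 <= t e_n. *)
Lemma ip_defect_null x t : null (fun n => cabs2 (ip (op (e_ n) x) (v t))).
Proof.
have nx := phi_Xdefect_null hilb A_lin A_sym A01 x.
apply: null_le nx => n; apply: le_trans (l2le_point t (A_ge _)) _.
rewrite -(phiX ip A) -phi_sqr //; exact: phi_Xdefect_sqr_le.
Qed.

(* The limit of e_n(A) is the projection onto the complement of M. *)
Lemma phi_defect_null x : M x -> null (fun n => phi (e_ n) x).
Proof.
move=> Mx; have [l hl] := op_defect_cvg hilb A_lin A_sym A01 x.
have Ml : M l.
  by apply: closed_span_cvg hl => // n; exact: closed_span_op.
(* The limit lies in [M] and is orthogonal to every [v t], hence to itself. *)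
have l0 : l = 0.
  apply: (hn2_eq0 hilb); rewrite /hn2 (closed_span_perp hilb _ Ml) //.
  move=> _ [t _ <-]; apply: cabs2_eq0.
  have h := hcvg_ipl hilb (v t) hl.
  have c2 : (0 : R) <= 2 by [].
  apply: null_const (null_add (null_scale c2 h)
    (null_scale c2 (ip_defect_null x t))) => n.
  rewrite -[cabs2 (_ - _)]cabs2N opprB; apply: le_trans (cabs2D_le _ _).
  by rewrite subrK.
apply: null_sqr; have h := hcvg_ipl hilb x hl.
apply: null_le h => n; rewrite l0 ip0l // subr0 /phi /cabs2.
by rewrite lerDl sqr_ge0.
Qed.

(** This is t p_n^2 = 1 - e_n read at [A]; the left side is the squared norm of the analysis of
    p_n(A)x. *)
Lemma phi_isqrt_le n x : complex.Re (ip (A (op (p_ n) x)) (op (p_ n) x)) =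
  hn2 x - phi (e_ n) x.
Proof. by rewrite -(phiX ip A) -phi_sqr // isqrt_defect phiB // phi1. Qed.

Variable w : T -> H.
Hypothesis w_cvg : forall t, hcvg (fun n => op (p_ n) (v t)) (w t).

Lemma parseval_in_span t : M (w t).
Proof.
apply: closed_span_cvg (w_cvg t) => // n; apply: closed_span_op.
by apply/closed_span_sub/hspan_sub => //; exists t.
Qed.

(** The coefficients against [w] are limits in l2, not only pointwise: on a finite set of indices,
    the Cauchy estimate [phi_XisqrtB] passes to the limit in its larger index, with a bound
    independent of the set. *)
Lemma Theta_isqrt_cvg x : exists d : nat -> R, null d /\ forall n,
  l2le (fun t => ip x (w t) - ip (op (p_ n) x) (v t)) (d n).
Proof.
have [l [l0 la nl]] := nonincreasing_cauchy
  (fun n => phi_defect_ge0 hilb A_lin A_sym A01 n x)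
  (phi_defect_decr hilb A_lin A_sym A01 x).
have c2 : (0 : R) <= 2 by [].
exists (fun n => 2 * (phi (e_ n) x - l)); split; first exact: null_scale.
move=> n s us; rewrite -subr_le0.
have hs : null (fun m =>
    \sum_(t <- s) cabs2 (ip x (op (p_ m) (v t)) - ip x (w t))).
  by apply: null_sum => t; exact: hcvg_ipr.
apply: (null_const_from (N := n) _ (null_scale c2 hs)) => m nm.
rewrite lerBlDr.
have h1 : \sum_(t <- s) cabs2 (ip (op (p_ m - p_ n) x) (v t)) <=
    phi (e_ n) x - l.
  apply: le_trans (A_ge _ us) _; rewrite -(phiX ip A) -phi_sqr //.
  apply: le_trans (phi_XisqrtB hilb A_lin A_sym A01 x nm) _.
  by have := la m; lra.
apply: le_trans (_ : \sum_(t <- s)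
  (2 * cabs2 (ip x (op (p_ m) (v t)) - ip x (w t)) +
   2 * cabs2 (ip (op (p_ m - p_ n) x) (v t))) <= _).
  apply: ler_sum => t _; rewrite opB ipBl // -op_sym //.
  rewrite -[cabs2 (_ - ip x _)]cabs2N opprB; apply: le_trans (cabs2D_le _ _).
  by rewrite addrA subrK.
by rewrite big_split /= -!mulr_sumr; lra.
Qed.

Lemma parseval_le x : l2le (fun t => ip x (w t)) (hn2 x).
Proof.
have [d [nd hd]] := Theta_isqrt_cvg x => s us.
apply: le_of_young (hn2_ge0 hilb x) nd _ => c n c0.
have hg : l2le (fun t => ip (op (p_ n) x) (v t)) (hn2 x).
  apply: l2le_trans (A_ge _); rewrite phi_isqrt_le.
  by have := phi_defect_ge0 hilb A_lin A_sym A01 n x; lra.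
exact: (l2le_young c0 hg (hd n) us).
Qed.

(** The analysis of p_n(A)x has squared norm |x|^2 - <e_n(A)x,x> and is l2-close to that of [x]
    against [w]. Membership in [M] makes the subtracted term vanish in the limit. *)
Lemma parseval_ge x c : M x -> l2le (fun t => ip x (w t)) c -> hn2 x <= c.
Proof.
move=> Mx xc; have c0 : 0 <= c by have := xc [::] isT; rewrite big_nil.
have [d [nd hd]] := Theta_isqrt_cvg x.
have ne := phi_defect_null Mx.
apply: le_of_young c0 (null_add nd ne) _ => b n b0.
have hg : l2le (fun t => ip (op (p_ n) x) (v t) - ip x (w t)) (d n).
  by move=> s us; under eq_bigr do rewrite -cabs2N opprB; exact: hd.
have := A_le (l2le_young b0 xc hg).
rewrite phi_isqrt_le => h; have bi : 0 < b^-1 by rewrite invr_gt0.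
have := phi_defect_ge0 hilb A_lin A_sym A01 n x; nra.
Qed.

(* y is sqrt(A) x. *)
Lemma Theta_factor x : exists2 y, M y & forall t, ip y (w t) = ip x (v t).
Proof.
have [y hy] := op_Xisqrt_cvg hilb A_lin A_sym A01 x.
exists y.
  apply: closed_span_cvg hy => // n; rewrite opM // opX; exact: A_M.
move=> t; apply/eqP; rewrite -subr_eq0; apply/eqP/cabs2_eq0.
have n1 := hcvg_ipr hilb y (w_cvg t).
have n2 := ip_defect_null x t.
have c4 : (0 : R) <= 4 by [].
have c2 : (0 : R) <= 2 by [].
apply: null_const (null_add (null_scale c2 n1) (null_scale c4
  (null_add hy n2))) => n.
(* The chain a, b, c, <x, v t> is split twice by [cabs2D_le], whence the weights 2, 4 and 4. *)
set a := ip y (w t); set b := ip y (op (p_ n) (v t)).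
set c := ip (op ('X * p_ n) x) (op (p_ n) (v t)).
have E : c - ip x (v t) = - ip (op (e_ n) x) (v t).
  rewrite /c -op_sym // -opM // mulrCA -expr2 isqrt_defect opB op1 ipBl //.
  by rewrite addrAC subrr add0r.
(* Moving p_n(A) to the left argument, this follows from <A p_n(A)z, p_n(A)z> <= |z|^2. *)
have h3 : cabs2 (b - c) <= hn2 (op ('X * p_ n) x - y).
  rewrite /b /c -ipBl // -op_sym //.
  apply: le_trans (l2le_point t (A_ge _)) _.
  rewrite phi_isqrt_le hn2BC //.
  have := phi_defect_ge0 hilb A_lin A_sym A01 n (y - op ('X * p_ n) x).
  lra.
have h1 := cabs2D_le (a - b) (b - ip x (v t)).
have h2 := cabs2D_le (b - c) (c - ip x (v t)).
rewrite addrA subrK in h1; rewrite addrA subrK in h2.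
rewrite E cabs2N in h2; rewrite -[cabs2 (b - a)]cabs2N opprB.
lra.
Qed.

Lemma Theta_approx x (eps : R) : 0 < eps ->
  exists z, l2le (fun t => ip x (w t) - ip z (v t)) eps.
Proof.
move=> e0; have [d [nd hd]] := Theta_isqrt_cvg x.
have [N /(_ N (leqnn _)) h] := nd _ e0.
by exists (op (p_ N) x); apply: l2le_trans (hd N); exact: ltW.
Qed.

(** Approximants are rewritten by [Theta_factor] as coefficients against [w] of vectors in [M];
    there [parseval_ge] makes these vectors Cauchy, and their limit represents [f]. *)
Lemma Theta_closed (f : T -> R[i]) :
  (forall eps : R, 0 < eps -> exists z, l2le (fun t => f t - ip z (v t)) eps) ->
  exists y, forall t, ip y (w t) = f t.
Proof.
move=> hf.
have hn n : exists y, M y /\ l2le (fun t => f t - ip y (w t)) n.+1%:R^-1.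
  have n0 : (0 : R) < n.+1%:R^-1 by rewrite invr_gt0 ltr0n.
  have [z hz] := hf _ n0.
  have [y My hy] := Theta_factor z; exists y; split=> // s us.
  by under eq_bigr do rewrite hy; exact: hz.
have [y_ hy] := choice hn.
have [y yy] : exists y, hcvg y_ y.
  apply: hn2_complete => // e e0; have e4 : 0 < e / 4 by lra.
  have [N hN] := null_inv e4; exists N => m n Nm mn.
  have Nn := leq_trans Nm mn.
  apply: le_lt_trans (_ : 2 * n.+1%:R^-1 + 2 * m.+1%:R^-1 < _); last first.
    by move: (n.+1%:R^-1) (m.+1%:R^-1) (hN _ Nn) (hN _ Nm) => a b; lra.
  apply: parseval_ge.
    rewrite addrC -scaleN1r; apply: closed_span_lin => //.
      exact: (hy n).1.
    exact: (hy m).1.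
  have := l2le_add (hy n).2 (l2le_opp (hy m).2).
  move=> h s us; have := h s us; congr (_ <= _); apply: eq_bigr => t _.
  by rewrite ipBl // opprB addrC addrA subrK.
exists y => t; apply/eqP; rewrite -subr_eq0; apply/eqP/cabs2_eq0.
have n1 := hcvg_ipl hilb (w t) yy.
have c2 : (0 : R) <= 2 by [].
apply: null_const (null_add (null_scale c2 n1) (null_scale c2
  (@null_inv R))) => n.
have := l2le_point t (hy n).2.
have := cabs2D_le (f t - ip (y_ n) (w t)) (ip (y_ n) (w t) - ip y (w t)).
rewrite addrA subrK -[cabs2 (f t - ip y _)]cabs2N opprB.
by move: (n.+1%:R^-1) => a; lra.
Qed.

End ParsevalFamily.

(** * The frame operator as a strong limit of finite sums *)

Section FrameOperator.
Variables (R : realType) (H : lmodType R[i]) (ip : H -> H -> R[i]).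
Hypothesis hilb : is_hilbert ip.
Variables (T : countType) (v : T -> H).
Local Notation hn2 := (hn2 ip).
Local Notation hcvg := (hcvg ip).
Hypothesis bessel : forall x, l2le (fun t => ip x (v t)) (hn2 x).
Local Notation M := (closed_span ip (v @` setT)).
Implicit Types (s : seq T) (x y : H).

Definition frame_op s x : H := \sum_(t <- s) ip x (v t) *: v t.

Lemma frame_op_lin s a x y :
  frame_op s (a *: x + y) = a *: frame_op s x + frame_op s y.
Proof.
rewrite /frame_op scaler_sumr -big_split; apply: eq_bigr => t _ /=.
by rewrite ip_lin // scalerDl scalerA.
Qed.

Lemma frame_op_sym s x y : ip (frame_op s x) y = ip x (frame_op s y).
Proof.
rewrite ip_suml // ip_sumr //; apply: eq_bigr => t _.
by rewrite ipZl // ipZr // -ip_conj // mulrC.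
Qed.

Lemma frame_op_quad s x :
  complex.Re (ip (frame_op s x) x) = \sum_(t <- s) cabs2 (ip x (v t)).
Proof.
rewrite ip_suml // Re_sum; apply: eq_bigr => t _.
by rewrite ipZl // (ip_conj hilb x) mulr_conj.
Qed.

(** The Bessel bound 1 puts the finite sum between 0 and the identity, so [contraction_sq] applies.
    Used on tails, it gives the Cauchy property. *)
Lemma frame_op_contract s x : uniq s ->
  hn2 (frame_op s x) <= \sum_(t <- s) cabs2 (ip x (v t)).
Proof.
move=> us; rewrite -frame_op_quad; apply: contraction_sq => //.
- by move=> y z; rewrite addrC -scaleN1r frame_op_lin scaleN1r addrC.
- exact: frame_op_sym.
move=> y; rewrite frame_op_quad bessel // andbT.
by apply: sumr_ge0 => t _; exact: cabs2_ge0.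
Qed.

(** The points with code below [n], possibly fewer than [n] of them; these lists are nested prefixes
    that exhaust [T]. *)
Definition first_points n : seq T := pmap pickle_inv (iota 0 n).

Lemma first_points_uniq n : uniq (first_points n).
Proof. exact: pmap_uniq (@pickle_invK T) _ (iota_uniq _ _). Qed.

Lemma first_points_cat m n : (m <= n)%N ->
  exists r, first_points n = first_points m ++ r.
Proof.
move=> /subnKC <-; rewrite /first_points iotaD pmap_cat.
by eexists.
Qed.

Lemma first_points_exhaust s :
  exists N, forall n, (N <= n)%N -> {subset s <= first_points n}.
Proof.
exists (\max_(t <- s) (pickle t).+1) => n sn t ts.
rewrite mem_pmap; apply/mapP; exists (pickle t); last by rewrite pickleK_inv.
rewrite mem_iota /=; apply: leq_trans sn.
by apply: (leq_bigmax_seq (F := fun t => (pickle t).+1)).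
Qed.

Lemma sum_cabs2_sub (f : T -> R[i]) s s' : uniq s -> uniq s' ->
  {subset s <= s'} -> \sum_(t <- s) cabs2 (f t) <= \sum_(t <- s') cabs2 (f t).
Proof.
move=> us us' ss'; rewrite [leRHS](bigID (mem s)) /=.
rewrite -[X in _ <= X + _]big_filter.
rewrite (perm_big [seq t <- s' | t \in s]) /=.
  by rewrite lerDl sumr_ge0 // => t _; exact: cabs2_ge0.
apply: uniq_perm => //; first exact: filter_uniq.
by move=> t; rewrite mem_filter andb_idr // => /ss'.
Qed.

Lemma frame_op_cvg x : exists l, hcvg (fun n => frame_op (first_points n) x) l.
Proof.
apply: (hcvg_monotone hilb (a :=
  fun n => hn2 x - \sum_(t <- first_points n) cabs2 (ip x (v t)))).
  by move=> n; rewrite subr_ge0 bessel // first_points_uniq.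
move=> m n /first_points_cat[r E].
have ur : uniq r by have := first_points_uniq n; rewrite E cat_uniq => /and3P[].
rewrite E hn2BC // {1}/frame_op !big_cat /= addrAC subrr add0r.
have := frame_op_contract x ur; rewrite /frame_op; lra.
Qed.

Lemma frame_operator : exists A : H -> H,
  [/\ forall (a : R[i]) x y, A (a *: x + y) = a *: A x + A y,
      forall x y, ip (A x) y = ip x (A y),
      forall x, M (A x),
      forall x, l2le (fun t => ip x (v t)) (complex.Re (ip (A x) x)) &
      forall x c, l2le (fun t => ip x (v t)) c -> complex.Re (ip (A x) x) <= c].
Proof.
have [A hA] := choice frame_op_cvg; exists A.
have c2 : (0 : R) <= 2 by [].
(* Error of the quadratic form; since [null] is one-sided, both [r] and its opposite are shown
   null. *)
pose r x n := complex.Re (ip (frame_op (first_points n) x) x - ip (A x) x).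
have nr x : null (r x).
  apply: null_sqr; have h := hcvg_ipl hilb x (hA x).
  by apply: null_le h => n; rewrite lerDl sqr_ge0.
have nrN x : null (fun n => - r x n).
  apply: null_sqr; have h := hcvg_ipl hilb x (hA x).
  by apply: null_le h => n; rewrite sqrrN lerDl sqr_ge0.
have rE x n : r x n =
    \sum_(t <- first_points n) cabs2 (ip x (v t)) - complex.Re (ip (A x) x).
  by rewrite /r ReD ReN frame_op_quad.
split.
- move=> a x y; apply: (hcvg_unique hilb (hA _)).
  have := hcvg_lin hilb a (hA x) (hA y).
  by apply: null_le => n; rewrite frame_op_lin.
- move=> x y; apply/eqP; rewrite -subr_eq0; apply/eqP/cabs2_eq0.
  have h1 := hcvg_ipl hilb y (hA x).
  have h2 := hcvg_ipr hilb x (hA y).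
  apply: null_const (null_add (null_scale c2 h1)
    (null_scale c2 h2)) => n.
  rewrite -frame_op_sym -[cabs2 (_ - ip (A x) y)]cabs2N opprB.
  apply: le_trans (cabs2D_le _ _); by rewrite addrA subrK.
- move=> x; apply: closed_span_cvg (hA x) => // n; apply: closed_span_sub => //.
  rewrite /frame_op; elim: (first_points n) => [|t s IH].
    by rewrite big_nil; exact: hspan0.
  by rewrite big_cons; apply: hspan_lin => //; apply: hspan_sub; exists t.
- move=> x s us; have [N hN] := first_points_exhaust s; rewrite -subr_le0.
  apply: (null_const_from (N := N) _ (nr x)) => n /hN sn.
  by rewrite rE lerB // sum_cabs2_sub // first_points_uniq.
- move=> x c xc; rewrite -subr_le0.
  apply: null_const (nrN x) => n; rewrite rE opprB lerB // xc //.
  exact: first_points_uniq.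
Qed.

End FrameOperator.

(* Polarization; real parts suffice since A is symmetric and U is onto. *)
Lemma commute_unitary (R : realType) (H : lmodType R[i]) (ip : H -> H -> R[i])
  (A U : H -> H) : is_hilbert ip -> Defs.is_unitary ip U ->
  (forall (a : R[i]) x y, A (a *: x + y) = a *: A x + A y) ->
  (forall x y, ip (A x) y = ip x (A y)) ->
  (forall x, complex.Re (ip (A (U x)) (U x)) = complex.Re (ip (A x) x)) ->
  forall x, A (U x) = U (A x).
Proof.
move=> hilb [U_lin U_ip U_surj] A_lin A_sym hq x.
have AD y z : A (y + z) = A y + A z by rewrite -[y in LHS]scale1r A_lin scale1r.
have UD y z : U (y + z) = U y + U z by rewrite -[y in LHS]scale1r U_lin scale1r.
have pol y : complex.Re (ip (A (U x)) (U y)) = complex.Re (ip (A x) y).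
  have := hq (x + y); rewrite UD !AD !(ipDl hilb) !(ipDr hilb) !ReD !hq.
  rewrite (A_sym (U y)) (ip_conj hilb (A (U x)) (U y)) cRe_conj.
  by rewrite (A_sym y x) (ip_conj hilb (A x) y) cRe_conj; lra.
have [y hy] := U_surj (A (U x) - U (A x)).
apply/eqP; rewrite -subr_eq0; apply/eqP/(hn2_eq0 hilb).
by rewrite /hn2 -{2}hy (ipBl hilb) ReD ReN pol U_ip subrr.
Qed.

(** * Extended-real sums versus bounds on partial sums *)

Section ExtendedSums.
Variables (R : realType) (T : choiceType).
Local Open Scope ereal_scope.

Lemma esum_cabs2_le (f : T -> R[i]) (c : R) :
  \esum_(t in [set: T]) (cabs2 (f t))%:E <= c%:E <-> l2le f c.
Proof.
split=> [h s us|h].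
  rewrite -lee_fin; apply: le_trans h; apply: esum_ge; exists [set` s] => //.
  by rewrite -fsbig_seq // sumEFin.
apply: ge_ereal_sup => _ [X [finX _] <-].
by rewrite fsbig_finite //= sumEFin lee_fin h.
Qed.

(** The sum, lying between 0 and [c], is a real number and itself bounds the partial sums, so
    minimality of [c] applies to it. *)
Lemma esum_cabs2_eq (f : T -> R[i]) (c : R) : l2le f c ->
  (forall d, l2le f d -> (c <= d)%R) ->
  \esum_(t in [set: T]) (cabs2 (f t))%:E = c%:E.
Proof.
move=> fc cf; apply/eqP; rewrite eq_le; apply/andP; split.
  exact/esum_cabs2_le.
have : \esum_(t in [set: T]) (cabs2 (f t))%:E <= c%:E by exact/esum_cabs2_le.
have : 0 <= \esum_(t in [set: T]) (cabs2 (f t))%:E.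
  by apply: esum_ge0 => t _; rewrite lee_fin cabs2_ge0.
case E: (\esum_(t in _) _) => [r| |] // _ _; rewrite lee_fin; apply: cf.
by apply/esum_cabs2_le; rewrite E.
Qed.

(** Merges the [k] orbits into one family indexed by pairs, to which the single-family results
    apply. *)
Lemma sum_esum_prod (k : nat) (f : 'I_k -> T -> R[i]) :
  \sum_(i < k) \esum_(g in [set: T]) (cabs2 (f i g))%:E =
  \esum_(t in [set: 'I_k * T]) (cabs2 (f t.1 t.2))%:E.
Proof.
have -> : [set: 'I_k * T] = [set: 'I_k] `*`` (fun=> [set: T]).
  by apply/seteqP; split.
rewrite -(esum_esum (a := fun i g => (cabs2 (f i g))%:E)); last first.
  by move=> i g _ _; rewrite lee_fin cabs2_ge0.
rewrite esum_fset; last 2 first.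
- exact: finite_finset.
- by move=> i _; apply: esum_ge0 => t _; rewrite lee_fin cabs2_ge0.
rewrite [LHS]fsbig_seq ?index_enum_uniq //; apply: eq_fsbigl.
by apply/seteqP; split=> // i _ /=; rewrite mem_index_enum.
Qed.

End ExtendedSums.

(** * Equivariance, and the orbit family for Bessel bound one *)

Section Orbit.
Variables (R : realType) (H : lmodType R[i]) (ip : H -> H -> R[i]).
Variables (G : countType) (mul : G -> G -> G) (one : G) (inv : G -> G).
Variables (pi : G -> H -> H) (k : nat) (xi : 'I_k -> H).
Hypothesis hilb : is_hilbert ip.
Hypothesis grp : is_group mul one inv.
Hypothesis rep : is_proj_unitary_rep ip mul pi.
Local Notation hn2 := (hn2 ip).
Local Notation T := ('I_k * G)%type.
Let v (t : T) := pi t.2 (xi t.1).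
Hypothesis bessel : forall x, l2le (fun t => ip x (v t)) (hn2 x).

Lemma rep_coef g h x y :
  cabs2 (ip (pi g x) (pi (mul g h) y)) = cabs2 (ip x (pi h y)).
Proof.
case: rep => U [mu [mu1 mum]]; case: (U g) => _ U_ip _.
rewrite -[in RHS]U_ip mum ipZr // cabs2M cabs2_conj.
by rewrite (cabs2_normr1 (mu1 g h)) mul1r.
Qed.

(** Up to unimodular factors, [pi g] shifts the coefficients by left translation by [g], which
    permutes the index set. Hence the quadratic form of the frame operator is invariant. *)
Lemma orbit_l2le g x c :
  l2le (fun t => ip (pi g x) (v t)) c <-> l2le (fun t => ip x (v t)) c.
Proof.
case: grp => mulA mul1 _ mulV mulV'.
have injm a : injective (fun t : T => (t.1, mul a t.2)).
  move=> [i b] [j d] [-> E]; congr (_, _).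
  by rewrite -[b]mul1 -[d]mul1 -(mulV a) -!mulA E.
split=> h s us.
  rewrite -(map_inj_uniq (injm g)) in us; apply: le_trans (h _ us).
  rewrite big_map; apply: ler_sum => t _.
  by rewrite /v /= rep_coef.
rewrite -(map_inj_uniq (injm (inv g))) in us; apply: le_trans (h _ us).
rewrite big_map; apply: ler_sum => t _; rewrite /v /=.
by rewrite -[leRHS](rep_coef g) mulA mulV' mul1.
Qed.

Lemma orbit_setE : orbit_set pi xi = v @` setT.
Proof.
apply/seteqP; split=> [y [i [g ->]]|_ [[i g] _ <-]]; first by exists (i, g).
by exists i, g.
Qed.

(** The analysis operator is linear, so its range is already a linear span. *)
Lemma l2span_Theta f : l2span (Theta ip pi xi @` setT) f <->
  exists x, f = Theta ip pi xi x.
Proof.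
split=> [[n [c [u [hu ->]]]]|[x ->]]; last first.
  exists 1%N, (fun=> 1), (fun=> Theta ip pi xi x); split.
    by move=> _; exists x.
  by apply/funext => i; apply/funext => g; rewrite big_ord1 mul1r.
have /choice[x hx] j : exists x, Theta ip pi xi x = u j.
  by have [x _ E] := hu j; exists x.
exists (\sum_(j < n) c j *: x j); apply/funext => i; apply/funext => g.
rewrite /Theta ip_suml //; apply: eq_bigr => j _.
by rewrite ipZl // -hx.
Qed.

Lemma parseval_orbit : exists eta : 'I_k -> H,
  is_parseval_frame_for ip pi (closed_span ip (orbit_set pi xi)) eta /\
  Theta ip pi eta @` setT = l2closed_span (Theta ip pi xi @` setT).
Proof.
have [A [A_lin A_sym A_M A_ge A_le]] := frame_operator hilb bessel.
have A01 x : 0 <= complex.Re (ip (A x) x) <= hn2 x.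
  rewrite (A_le _ _ (bessel x)) andbT.
  by have := A_ge x [::] isT; rewrite big_nil.
have [w hw] := isqrt_family_cvg hilb A_lin A_sym A01 A_ge.
have U g : Defs.is_unitary ip (pi g) by case: rep.
have A_pi g x : A (pi g x) = pi g (A x).
  apply: (commute_unitary hilb (U g) A_lin A_sym) => y.
  apply/eqP; rewrite eq_le; apply/andP; split; apply: A_le.
    exact: (orbit_l2le g y _).2 (A_ge _).
  exact: (orbit_l2le g y _).1 (A_ge _).
have op_pi p g x : op A p (pi g x) = pi g (op A p x).
  by apply: op_comm => //; case: (U g).
have pi_hn2 g x y : hn2 (pi g x - pi g y) = hn2 (x - y).
  case: (U g) => lin isom _; rewrite /hn2.
  by rewrite addrC -scaleN1r -lin isom scaleN1r addrC.
(* In a projective representation [pi one] need not be the identity, so [eta i] is a preimage of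
   [w (i, one)] rather than that vector. *)
have /choice[eta heta] i : exists y, pi one y = w (i, one).
  by case: (U one) => _ _; apply.
have eta_cvg i : hcvg ip (fun n => op A (isqrt R n) (xi i)) (eta i).
  apply: null_le (hw (i, one)) => n.
  by rewrite -heta /v op_pi pi_hn2.
have wE i g : pi g (eta i) = w (i, g).
  apply: (hcvg_unique hilb _ (hw (i, g))).
  by apply: null_le (eta_cvg i) => n; rewrite /v op_pi pi_hn2.
exists eta; split; first split.
- move=> i g; rewrite wE orbit_setE.
  exact: (parseval_in_span hilb A_M hw).
- move=> x; rewrite orbit_setE hnorm2 // => Mx.
  rewrite /frame_sum (sum_esum_prod (fun i g => ip x (pi g (eta i)))).
  have E : (fun t : T => ip x (pi t.2 (eta t.1))) = (fun t => ip x (w t)).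
    by apply/funext => -[i g] /=; rewrite wE.
  apply: esum_cabs2_eq; rewrite E.
    exact: (parseval_le hilb A_lin A_sym A01 A_ge hw).
  move=> d; exact: (parseval_ge hilb A_lin A_sym A01 A_M A_ge A_le hw).
apply/seteqP; split=> [_ [x _ <-] eps e0|f hf].
  (* Half of [eps] turns the weak bound of [l2le] into the strict one required by the closure. *)
  have e2 : 0 < eps / 2 by lra.
  have [z hz] := Theta_approx hilb A_lin A_sym A01 A_ge hw x e2.
  exists (Theta ip pi xi z); first by apply/l2span_Theta; exists z.
  apply: le_lt_trans (_ : (eps / 2)%:E < _)%E; last by rewrite lte_fin; lra.
  rewrite /l2dist2 sum_esum_prod; apply/esum_cabs2_le => s us.
  apply: le_trans (hz _ us); apply: ler_sum => -[i g] _.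
  by rewrite /Theta /= wE.
have [y hy] : exists y, forall t, ip y (w t) = f t.1 t.2.
  apply: (Theta_closed hilb A_lin A_sym A01 A_M A_ge A_le hw).
  move=> eps /hf[f' /l2span_Theta[z ->]].
  rewrite /l2dist2 sum_esum_prod => /ltW /esum_cabs2_le h.
  by exists z.
exists y => //; apply/funext => i; apply/funext => g.
by rewrite /Theta wE hy.
Qed.

End Orbit.

(** * Reduction of a general Bessel bound to one by rescaling *)

Unset Implicit Arguments.

Theorem lemma3p4 (R : realType) (H : lmodType R[i]) (ip : H -> H -> R[i])
  (G : countType) (mul : G -> G -> G) (one : G) (inv : G -> G)
  (pi : G -> H -> H) (k : nat) (xi : 'I_k -> H) :
  is_hilbert ip ->
  is_group mul one inv ->
  is_proj_unitary_rep ip mul pi ->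
  is_bessel ip pi xi ->
  let M := closed_span ip (orbit_set pi xi) in
  exists eta : 'I_k -> H,
    is_parseval_frame_for ip pi M eta /\
    Theta ip pi eta @` [set: H] = l2closed_span (Theta ip pi xi @` [set: H]).
Proof.
move=> hilb grp rep [B hB] M.
(* Scaling by [b] divides the Bessel bound by max(B, 1); the maximum guards against [B] being
   nonpositive. *)
pose b : R := (Num.sqrt (Num.max B 1))^-1.
have m0 : 0 < Num.max B 1 by rewrite lt_max ltr01 orbT.
have b0 : 0 < b by rewrite invr_gt0 sqrtr_gt0.
have bB : b ^+ 2 * B <= 1.
  rewrite exprVn (sqr_sqrtr (ltW m0)) mulrC ler_pdivrMr // mul1r.
  by rewrite le_max lexx.
have bC0 : (b%:C)%C != 0.
  by rewrite -[0]/((0 : R)%:C)%C (inj_eq (@complexI R)) gt_eqF.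
pose xi' i := (b%:C)%C *: xi i.
have pi0 g x : pi g ((b%:C)%C *: x) = (b%:C)%C *: pi g x.
  case: rep => /(_ g)[lin _ _] _.
  by rewrite -[_ *: x]addr0 lin (linear_fun0 lin) addr0.
(* As [b] is real, scaling the generators amounts to scaling [x]; scaling being a bijection of [H],
   the range of the analysis operator does not change. *)
have ThetaE x : Theta ip pi xi' x = Theta ip pi xi ((b%:C)%C *: x).
  apply/funext => i; apply/funext => g; rewrite /Theta pi0 ipZr // ipZl //.
  by rewrite [X in X * _]conjc_real.
have bess x : l2le (fun t : 'I_k * G => ip x (pi t.2 (xi' t.1))) (hn2 ip x).
  apply/esum_cabs2_le; have := hB ((b%:C)%C *: x).
  rewrite /frame_sum sum_esum_prod hnorm2 // hn2Z // cabs2_real.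
  have -> : (fun t : 'I_k * G =>
      (cabs2 (ip ((b%:C)%C *: x) (pi t.2 (xi t.1))))%:E) =
      (fun t : 'I_k * G => (cabs2 (ip x (pi t.2 (xi' t.1))))%:E).
    apply/funext => t; congr (cabs2 _)%:E.
    exact: esym (congr1 (fun F => F t.1 t.2) (ThetaE x)).
  move=> h; apply: le_trans h _; rewrite lee_fin.
  rewrite mulrA [B * _]mulrC -[leRHS]mul1r; apply: ler_wpM2r => //.
  exact: hn2_ge0.
have [eta [hpar hTh]] := parseval_orbit hilb grp rep bess.
exists eta; split.
  have ME : M = closed_span ip (orbit_set pi xi').
    apply/seteqP; split=> y.
      apply: (closed_span_scale hilb bC0) => _ [i [g ->]].
      by exists i, g; rewrite pi0.
    apply: (closed_span_scale hilb (invr_neq0 bC0)) => _ [i [g ->]].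
    by exists i, g; rewrite pi0 scalerA mulVf // scale1r.
  by rewrite ME.
rewrite hTh; congr l2closed_span; apply/seteqP; split=> _ [x _ <-].
  by exists ((b%:C)%C *: x).
exists ((b%:C)%C^-1 *: x) => //; rewrite ThetaE scalerA divff //.
by rewrite scale1r.
Qed.
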